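(* Let $a\in\mathbb{N}^n$ and $b\in\mathbb{N}^m$ with $a$ nonincreasing, $\max_i b_i\le n$, and $\sum_{i\le n}a_i=\sum_{i\le m}b_i$. Let $C\in\{0,1\}^{m\times n}$. (I) If $C$ is $b$-fillable, then the following are equivalent: (1) there exists a matrix in $\{0,1\}^{m\times n}$ that fills $C$ and has column sums $a$ and row sums $b$; (2) $a\trianglelefteq b^{1,C}$; (3) $\sum_{i\le k}a_i\le\sum_{i\le k}b^{1,C}_i$ for all $k\in\{1,\dots,n\}$; (4) $\sum_{i\le k}a_i\le\sum_{i\le k}b^{1,C}_i$ for all $k\in C(a)$. (II) If $C$ is $b$-avoidable, then the following are equivalent: (1) there exists a matrix in $\{0,1\}^{m\times n}$ that avoids $C$ and has column sums $a$ and row sums $b$; (2) $a\trianglelefteq b^{0,C}$; (3) $\sum_{i\le k}a_i\le\sum_{i\le k}b^{0,C}_i$ for all $k\in\{1,\dots,n\}$; (4) $\sum_{i\le k}a_i\le\sum_{i\le k}b^{0,C}_i$ for all $k\in C(a)$. (Here $C(a)$ denotes the set of corners of $a$, not to be confused with the matrix $C$.)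
   Context: $\mathbb{N}=\{0,1,2,\dots\}$. For $x,y\in\mathbb{N}^n$, $x\trianglelefteq y$ means $\sum_{i\le k}x_i\le\sum_{i\le k}y_i$ for all $k\in\{1,\dots,n\}$. For nonincreasing $a\in\mathbb{N}^n$, the set of corners is $C(a)=\{k:1\le k\le n,\ a_k>a_{k+1}\}$ with the convention $a_{n+1}=0$. For matrices $A,B\in\mathbb{N}^{m\times n}$, $A\trianglelefteq B$ means that the vectors $\alpha,\beta$ of column sums of $A,B$ satisfy $\alpha\trianglelefteq\beta$; if a finite set $S\subset\mathbb{N}^{m\times n}$ has a unique maximal element with respect to $\trianglelefteq$, the generalized conjugate of $S$ is the vector of column sums of this maximal element. Let $C\in\{0,1\}^{m\times n}$. $C$ is $b$-fillable if $\sum_j C_{ij}\le b_i$ for all $i$ and $\sum_i C_{ij}\le1$ for all $j$. $C$ is $b$-avoidable if $\sum_jC_{ij}\le n-b_i$ for all $i$ and $\sum_iC_{ij}\le1$ for all $j$. A matrix $A\in\{0,1\}^{m\times n}$ fills $C$ if $A_{ij}=1$ whenever $C_{ij}=1$, and avoids $C$ if $A_{ij}=0$ whenever $C_{ij}=1$. For $C$ $b$-fillable (and $\max_i b_i\le n$), $b^{1,C}\in\mathbb{N}^n$ is the generalized conjugate of the set of matrices in $\{0,1\}^{m\times n}$ with row sums $b$ that fill $C$; explicitly, $\sum_{i\le k}b^{1,C}_i=\sum_{i\le m}\min\{k,\ b_i-C_{i,k+1}-\cdots-C_{i,n}\}$. For $C$ $b$-avoidable, $b^{0,C}\in\mathbb{N}^n$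 is the generalized conjugate of the set of matrices in $\{0,1\}^{m\times n}$ with row sums $b$ that avoid $C$; explicitly, $\sum_{i\le k}b^{0,C}_i=\sum_{i\le m}\min\{k-C_{i,1}-\cdots-C_{i,k},\ b_i\}$. *)

(* Defs.v *)
From mathcomp Require Import all_boot all_algebra.

Set Implicit Arguments.
Unset Strict Implicit.
Unset Printing Implicit Defensive.

(* Positions k are 1-based, in {1, ..., n}, throughout: the entry x_k
   is nth 0 x k.-1, and nth returns 0 past the end, so that x_(n+1) = 0. *)

(* x_1 + ... + x_k *)
Definition psum n (x : n.-tuple nat) (k : nat) : nat :=
  \sum_(0 <= i < k) nth 0 x i.

Definition dominated n (x y : n.-tuple nat) : bool :=
  [forall k : 'I_n, psum x k.+1 <= psum y k.+1].

Definition corners n (a : n.-tuple nat) : pred nat :=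
  [pred k | (0 < k <= n) && (nth 0 a k < nth 0 a k.-1)].

Section BinaryMatrices.

Variables m n : nat.
Implicit Types (A B C : 'M[bool]_(m, n)) (b : m.-tuple nat).
Implicit Types (S : {set 'M[bool]_(m, n)}).

Definition rowsums A : m.-tuple nat := [tuple \sum_(j < n) A i j | i < m].
Definition colsums A : n.-tuple nat := [tuple \sum_(i < m) A i j | j < n].

Definition mdominated A B : bool := dominated (colsums A) (colsums B).

(* mdominated is only a preorder on matrices, hence B need not be equal to A. *)
Definition maximals S : {set 'M[bool]_(m, n)} :=
  [set A in S | [forall B in S, mdominated A B ==> mdominated B A]].

(* Junk value: the zero vector, when S has no unique maximal element. *)
Definition gconj S : n.-tuple nat :=
  if [pick A | maximals S == [set A]] is Some A then colsums A
  else [tuple 0 | _ < n].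

Definition fills A C : bool := [forall i, forall j, C i j ==> A i j].
Definition avoids A C : bool := [forall i, forall j, C i j ==> ~~ A i j].

Definition fillable b C : bool :=
  [forall i : 'I_m, \sum_(j < n) C i j <= tnth b i]
  && [forall j : 'I_n, \sum_(i < m) C i j <= 1].

(* The truncated subtraction is exact as long as all entries of b are at
   most n. *)
Definition avoidable b C : bool :=
  [forall i : 'I_m, \sum_(j < n) C i j <= n - tnth b i]
  && [forall j : 'I_n, \sum_(i < m) C i j <= 1].

(* b^{1,C} *)
Definition conj1 b C : n.-tuple nat :=
  gconj [set A | (rowsums A == b) && fills A C].

(* b^{0,C} *)
Definition conj0 b C : n.-tuple nat :=
  gconj [set A | (rowsums A == b) && avoids A C].

End BinaryMatrices.

(* Main.v *)
(* Filling and avoiding are treated at once, as filling C and avoiding D when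
   for any columns j and l at most one row i has C_ij = 1 or D_il = 1.  Then a
   1 can be moved from column j to column l inside some row as soon as column
   j has at least two more 1s than column l.  A feasible matrix in which no 1
   can be moved to the left has the largest prefix sums row by row, hence is
   the unique maximal one; and no column sum of it exceeds an earlier one by
   more than 1, which reduces domination to the corners of a.  Conversely,
   among the feasible matrices whose column sums dominate a, one with its 1s
   as far to the right as possible has column sums a. *)

Require Import Defs.
From mathcomp Require Import all_boot all_algebra.
From mathcomp Require Import zify.

Set Implicit Arguments.
Unset Strict Implicit.
Unset Printing Implicit Defensive.

(** * Prefix sums and domination *)

Lemma psumE n (x : n.-tuple nat) k : psum x k = \sum_(j < n | j < k) tnth x j.
Proof.
rewrite /psum; transitivity (\sum_(0 <= j < n | j < k) nth 0 x j); last first.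
  by rewrite big_mkord; apply: eq_bigr => j _; rewrite (tnth_nth 0).
have [le_kn|lt_nk] := leqP k n; first by rewrite [LHS](big_nat_widen _ _ _ _ _ le_kn).
(* For [k > n] the terms past the end of [x] are the default 0 of [nth]. *)
rewrite (big_cat_nat (n := n)) ?(ltnW lt_nk) //= [X in _ + X]big_nat_cond.
rewrite [X in _ + X]big1 ?addn0 => [|j]; last first.
  by case/andP=> /andP[le_nj _] _; rewrite nth_default ?size_tuple.
rewrite big_nat_cond [RHS]big_nat_cond; apply: eq_bigl => j.
by case: ltnP; rewrite ?andbF //= => /ltn_trans ->.
Qed.

Lemma psumS n (x : n.-tuple nat) k : psum x k.+1 = psum x k + nth 0 x k.
Proof. by rewrite /psum big_nat_recr. Qed.

Lemma psum0 n (x : n.-tuple nat) : psum x 0 = 0.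
Proof. by rewrite /psum big_nil. Qed.

Lemma dominatedP n (x y : n.-tuple nat) :
  reflect (forall k, k <= n -> psum x k <= psum y k) (dominated x y).
Proof.
apply: (iffP forallP) => [xy [|k] lt_kn|xy k]; last exact/xy/ltn_ord.
  by rewrite !psum0.
exact: (xy (Ordinal lt_kn)).
Qed.

Lemma psum_inj n (x y : n.-tuple nat) :
  (forall k, k <= n -> psum x k = psum y k) -> x = y.
Proof.
move=> xy; apply: eq_from_tnth => j; rewrite !(tnth_nth 0).
have := xy j.+1 (ltn_ord j).
by rewrite !psumS (xy j (ltnW (ltn_ord j))) => /addnI.
Qed.

Lemma nth_nonincr n (a : n.-tuple nat) (j l : nat) :
  sorted geq a -> j <= l -> nth 0 a l <= nth 0 a j.
Proof.
move=> sa le_jl; have [lt_ln|le_nl] := ltnP l n; last first.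
  by rewrite (nth_default _ (s := a)) ?size_tuple.
have geq_trans : transitive geq.
  by move=> x y z; rewrite /geq /= => /[swap]; apply: leq_trans.
apply: (sorted_leq_nth geq_trans leqnn 0 sa _ _ _ _ le_jl); rewrite inE size_tuple //.
exact: leq_ltn_trans le_jl lt_ln.
Qed.

(* If a first exceeds c at k, then a_k > c_k, and as long as a stays constant
   the entries of c stay at most a_k, so that the excess persists up to the
   next corner. *)
Lemma psum_le_corners n (a c : n.-tuple nat) :
  sorted geq a ->
  (forall j l, j < l < n -> nth 0 c l <= (nth 0 c j).+1) ->
  (forall k, k \in corners a -> psum a k <= psum c k) ->
  forall k, k <= n -> psum a k <= psum c k.
Proof.
move=> sa c_up ac k0 le_k0n; rewrite leqNgt; apply/negP => lt_k0.
have: exists k, (k <= n) && (psum c k < psum a k) by exists k0; rewrite le_k0n.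
case/ex_minnP => -[|j] /andP[lt_jn lt_ca] minj; first by rewrite !psum0 in lt_ca.
have le_ac : psum a j <= psum c j.
  rewrite leqNgt; apply/negP => lt_j.
  by have := minj j; rewrite lt_j (ltnW lt_jn) ltnn => /(_ isT).
have lt_j : nth 0 c j < nth 0 a j by move: lt_ca; rewrite !psumS; lia.
have noncorner k : 0 < k <= n -> psum c k < psum a k -> nth 0 a k = nth 0 a k.-1.
  move=> k_n lt_k; apply/eqP; rewrite eqn_leq nth_nonincr ?leq_pred //=.
  rewrite leqNgt; apply/negP => lt_a; have := ac k.
  by rewrite inE k_n lt_a => /(_ isT); lia.
have excess t : j + t < n ->
    psum c (j + t).+1 < psum a (j + t).+1 /\ nth 0 a (j + t) = nth 0 a j.
  elim: t => [|t IHt]; rewrite ?addn0 // addnS => lt_tn.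
  have [lt_t eq_t] := IHt (ltnW lt_tn).
  have eq_a : nth 0 a (j + t).+1 = nth 0 a j by rewrite noncorner //= (ltnW lt_tn).
  (* By [c_up] the next entry of [c] is at most [(nth 0 c j).+1], hence at most [nth 0 a j], which
     is the next entry of [a]: the gap cannot shrink. *)
  split=> //; rewrite psumS [psum a _]psumS eq_a.
  by have := c_up j (j + t).+1; lia.
have [] := excess (n - j.+1); first by lia.
have -> : j + (n - j.+1) = n.-1 by lia.
have n_gt0 : 0 < n by lia.
(* At [k = n] the convention that [a] is 0 past its end makes the last entry of [a] equal to 0, yet
   it equals [nth 0 a j > nth 0 c j]. *)
rewrite prednK // => /noncorner; rewrite n_gt0 leqnn => /(_ isT).
by rewrite nth_default ?size_tuple // => <-; lia.
Qed.

(** * Subsets of prescribed size *)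

Lemma sum_boolE (T : finType) (P : pred T) : \sum_x P x = #|[set x | P x]|.
Proof.
rewrite -sum1_card [RHS]big_mkcond; apply: eq_bigr => x _.
by rewrite inE; case: (P x).
Qed.

Lemma subset_card_between (T : finType) (X Y : {set T}) k :
  X \subset Y -> #|X| <= k <= #|Y| ->
  exists Z : {set T}, [/\ X \subset Z, Z \subset Y & #|Z| = k].
Proof.
move=> sXY; elim: k => [|k IHk] /andP[Xk kY].
  by exists X; split=> //; apply/eqP; rewrite -leqn0.
move: Xk; rewrite leq_eqVlt => /predU1P[|Xk]; first by exists X.
have [|Z [sXZ sZY cZ]] := IHk; first by rewrite -ltnS Xk ltnW.
have /properP[_ [y yY yZ]] : Z \proper Y by rewrite properEcard sZY cZ.
exists (y |: Z); rewrite cardsU1 yZ cZ subUset sub1set yY sZY; split=> //.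
exact: subset_trans sXZ (subsetUr _ _).
Qed.

(** * Feasible matrices and moves of a 1 inside a row *)

Section Exchange.

Variables m n : nat.
Implicit Types (A B C D : 'M[bool]_(m, n)) (b : m.-tuple nat) (a : n.-tuple nat).

Lemma nth_colsums A (j : 'I_n) : nth 0 (colsums A) j = \sum_i A i j.
Proof. by rewrite -tnth_nth tnth_mktuple. Qed.

Lemma psum_colsums A k :
  psum (colsums A) k = \sum_i \sum_(j < n | j < k) A i j.
Proof.
rewrite psumE exchange_big /=; apply: eq_bigr => j _.
by rewrite tnth_mktuple.
Qed.

Definition feasible b C D : {set 'M[bool]_(m, n)} :=
  [set A | [&& rowsums A == b, fills A C & avoids A D]].

Lemma feasibleP b C D A :
  reflect [/\ forall i, \sum_j A i j = tnth b i, forall i j, C i j -> A i j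
            & forall i j, D i j -> ~~ A i j]
    (A \in feasible b C D).
Proof.
rewrite inE; apply: (iffP and3P) => [[/eqP <- fC aD]|[rb fC aD]]; split.
- by move=> i; rewrite tnth_mktuple.
- by move=> i j; apply/implyP; move/forallP/(_ i)/forallP/(_ j): fC.
- by move=> i j; apply/implyP; move/forallP/(_ i)/forallP/(_ j): aD.
- by apply/eqP/eq_from_tnth => i; rewrite tnth_mktuple.
- by apply/forallP => i; apply/forallP => j; apply/implyP/fC.
- by apply/forallP => i; apply/forallP => j; apply/implyP/aD.
Qed.

(** The constraints do not link different rows, so each row can be chosen separately, as a set of
    columns of size [tnth b i] lying between the forced columns and the allowed ones. *)
Lemma feasible_exists b C D :
  (forall i, \sum_j C i j <= tnth b i) ->
  (forall i, tnth b i + \sum_j D i j <= n) ->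
  (forall i j, C i j -> ~~ D i j) ->
  exists A, A \in feasible b C D.
Proof.
move=> Cb bD CD.
have rowZ i : exists Z : {set 'I_n},
    [/\ [set j | C i j] \subset Z, Z \subset ~: [set j | D i j] & #|Z| = tnth b i].
  apply: subset_card_between.
    by apply/subsetP => j; rewrite !inE; apply: CD.
  rewrite -sum_boolE Cb; have := bD i.
  by rewrite sum_boolE -[n in _ <= n]card_ord -(cardsC [set j | D i j]) addnC leq_add2l.
have [Z ZP] := fin_all_exists rowZ.
exists (\matrix_(i, j) (j \in Z i))%R; apply/feasibleP; split=> i; last 2 first.
- by move=> j Cij; have [/subsetP sC _ _] := ZP i; rewrite mxE sC ?inE.
- move=> j Dij; have [_ /subsetP sD _] := ZP i; rewrite mxE.
  by apply/negP => /sD; rewrite !inE Dij.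
have [_ _ <-] := ZP i; rewrite -sum1_card [RHS]big_mkcond.
by apply: eq_bigr => j _; rewrite mxE; case: ifP.
Qed.

Definition shift A i p q : 'M[bool]_(m, n) :=
  (\matrix_(x, y) if (x == i) && (y == p) then false
                  else if (x == i) && (y == q) then true else A x y)%R.

Definition shiftable C D A i p q :=
  [&& A i p, ~~ A i q, ~~ C i p & ~~ D i q].

(** Each side receives the indicator of one changed entry, so that no truncated subtraction occurs;
    the later shift identities keep this shape. *)
Lemma shift_entry A i p q x y : A i p -> ~~ A i q ->
  shift A i p q x y + ((x == i) && (y == p)) = A x y + ((x == i) && (y == q)).
Proof.
move=> Ap Aq; have neq_pq : p != q by apply: contraNneq Aq => <-.
rewrite mxE; have [->|//] := eqVneq x i.
have [->|] := eqVneq y p; first by rewrite Ap (negPf neq_pq).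
by have [->|] := eqVneq y q; rewrite ?(negPf Aq) // !addn0.
Qed.

Lemma sum_delta (p : 'I_n) (P : pred 'I_n) (F : 'I_n -> nat) :
  \sum_(y | P y) (y == p) * F y = P p * F p.
Proof.
rewrite (eq_bigr (fun y => if y == p then F y else 0)); last first.
  by move=> y _; case: eqP; rewrite ?mul1n.
rewrite -big_mkcondr /=; case Pp: (P p); last first.
  by rewrite big_pred0 // => y; case: eqP => [->|]; rewrite ?Pp ?andbF.
rewrite mul1n (big_pred1 p) // => y /=.
by case: eqP => [->|]; rewrite ?Pp ?andbF.
Qed.

Lemma shift_row A i p q (P : pred 'I_n) F x : A i p -> ~~ A i q ->
  \sum_(y | P y) shift A i p q x y * F y + (x == i) * (P p * F p) =
  \sum_(y | P y) A x y * F y + (x == i) * (P q * F q).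
Proof.
move=> Ap Aq; rewrite -!sum_delta !big_distrr -!big_split /=.
by apply: eq_bigr => y _; rewrite !mulnA !mulnb -!mulnDl shift_entry.
Qed.

(** Taking [F = 1] and an initial segment for [P] yields the change of a prefix sum; taking all
    columns and [F] the column index yields the change of [colweight]. *)
Lemma shift_sum A i p q (P : pred 'I_n) F : A i p -> ~~ A i q ->
  \sum_x \sum_(y | P y) shift A i p q x y * F y + P p * F p =
  \sum_x \sum_(y | P y) A x y * F y + P q * F q.
Proof.
move=> Ap Aq.
have delta c : \sum_x (x == i) * c = c.
  by rewrite -big_distrl /= sum_boolE cardsE card1 mul1n.
rewrite -[P p * _]delta -[P q * _]delta -!big_split /=.
by apply: eq_bigr => x _; rewrite shift_row.
Qed.

Lemma shift_feasible b C D A i p q :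
  A \in feasible b C D -> shiftable C D A i p q ->
  shift A i p q \in feasible b C D.
Proof.
case/feasibleP=> rb fC aD /and4P[Ap Aq Cp Dq]; apply/feasibleP; split=> x.
- rewrite -rb; have := shift_row xpredT (fun=> 1) x Ap Aq.
  under eq_bigr do rewrite muln1.
  by under [X in _ = X + _]eq_bigr do rewrite muln1; move/addIn.
- move=> y Cxy; rewrite mxE; case: ifP => [/andP[/eqP ex /eqP ey]|_].
    by rewrite -ex -ey Cxy in Cp.
  by case: ifP => // _; apply: fC.
- move=> y Dxy; rewrite mxE; case: ifP => // _.
  case: ifP => [/andP[/eqP ex /eqP ey]|_]; last exact: aD.
  by rewrite -ex -ey Dxy in Dq.
Qed.

Lemma psum_shift A i p q k : A i p -> ~~ A i q ->
  psum (colsums (shift A i p q)) k + (p < k) = psum (colsums A) k + (q < k).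
Proof.
move=> Ap Aq; have := shift_sum (fun y => y < k) (fun=> 1) Ap Aq.
have mul1 B : \sum_x \sum_(y < n | y < k) B x y * 1 = psum (colsums B) k.
  by rewrite psum_colsums; do 2!(apply: eq_bigr => ? _); rewrite muln1.
by rewrite !mul1 !muln1.
Qed.

(** A potential: every move of a 1 changes it by the signed distance moved. Its minimizers are
    leftmost, and its maximizers serve to reach prescribed column sums. *)
Definition colweight A := \sum_i \sum_(j < n) A i j * j.

Lemma colweight_shift A i p q : A i p -> ~~ A i q ->
  colweight (shift A i p q) + p = colweight A + q.
Proof.
move=> Ap Aq; have := shift_sum xpredT (fun y => val y) Ap Aq.
by rewrite !mul1n.
Qed.

(** * Leftmost matrices and the generalized conjugate *)

Definition leftmost C D A := forall i (p q : 'I_n), q < p -> ~~ shiftable C D A i p q.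

Lemma leftmost_exists b C D :
  (exists A, A \in feasible b C D) ->
  exists2 M, M \in feasible b C D & leftmost C D M.
Proof.
case=> A0 A0S; case: (arg_minnP colweight A0S) => M MS minM; exists M => //.
move=> i p q lt_qp; apply/negP => sh; have := minM _ (shift_feasible MS sh).
by case/and4P: sh => Mp Mq _ _; have := colweight_shift Mp Mq; lia.
Qed.

Lemma sum_lt_ex (P : pred 'I_n) (f g : 'I_n -> bool) :
  \sum_(j | P j) g j < \sum_(j | P j) f j -> exists j, [/\ P j, f j & ~~ g j].
Proof.
move=> lt_gf; case: (pickP (fun j => [&& P j, f j & ~~ g j])) => [j /and3P|no].
  by exists j.
move: lt_gf; rewrite ltnNge leq_sum // => j Pj.
by have := no j; rewrite Pj; case: (f j) (g j) => [] [].
Qed.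

(** If row [i] of [A] had more 1s before [k], then [A] has a 1 and [M] a 0 at some [q < k]; the row
    sums being equal, [M] has a 1 and [A] a 0 at some [p >= k]. Since [A] is feasible, neither [C]
    at [p] nor [D] at [q] blocks the move from [p] to [q] in [M]. *)
Lemma leftmost_row_max b C D A M i k :
  A \in feasible b C D -> M \in feasible b C D -> leftmost C D M ->
  \sum_(j < n | j < k) A i j <= \sum_(j < n | j < k) M i j.
Proof.
case/feasibleP=> rA fA aA /feasibleP[rM _ _] lM; rewrite leqNgt; apply/negP => lt_MA.
have [q [lt_qk Aq Mq]] := sum_lt_ex lt_MA.
have [] := @sum_lt_ex (fun j => ~~ (j < k)) (M i) (A i).
  have := rA i; rewrite -rM (bigID (fun j : 'I_n => j < k)) /=.
  rewrite [X in _ = X](bigID (fun j : 'I_n => j < k)) /= => sumE.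
  by rewrite -(ltn_add2l (\sum_(j < n | j < k) A i j)) sumE ltn_add2r.
move=> p [le_kp Mp Ap]; have lt_qp : q < p by rewrite (leq_trans lt_qk) // leqNgt.
case/negP: (lM i p q lt_qp).
by apply/and4P; split=> //; [apply: contra Ap => /fA | apply/negP => /aA /negP].
Qed.

Lemma leftmost_dominates b C D A M :
  A \in feasible b C D -> M \in feasible b C D -> leftmost C D M ->
  mdominated A M.
Proof.
move=> AS MS lM; apply/dominatedP => k _; rewrite !psum_colsums.
by apply: leq_sum => i _; apply: leftmost_row_max AS MS lM.
Qed.

(** Equal prefix sums of the columns force equality in each rowwise inequality of
    [leftmost_row_max], and the prefix counts of a row determine its entries. *)
Lemma leftmost_unique b C D A M :
  A \in feasible b C D -> M \in feasible b C D -> leftmost C D M ->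
  mdominated M A -> A = M.
Proof.
move=> AS MS lM /dominatedP MA.
have rowE i k : k <= n -> \sum_(j < n | j < k) A i j = \sum_(j < n | j < k) M i j.
  move=> le_kn; apply/eqP; move: i; apply/forallP.
  (* Equality case of a sum of termwise inequalities. *)
  have [_ <-] := leqif_sum (P := xpredT)
    (fun i _ => leqif_eq (leftmost_row_max i k AS MS lM)).
  rewrite -!psum_colsums eqn_leq MA // andbT !psum_colsums.
  by apply: leq_sum => i _; apply: leftmost_row_max AS MS lM.
have recr B i (j : 'I_n) :
    \sum_(l < n | l < j.+1) B i l = B i j + \sum_(l < n | l < j) B i l.
  rewrite (bigD1 j) ?leqnn //=; congr addn; apply: eq_bigl => l.
  by rewrite ltnS [RHS]ltn_neqAle andbC.
apply/matrixP => i j; have := rowE i j.+1 (ltn_ord j).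
rewrite !recr rowE; last exact/ltnW.
by case: (A i j) (M i j) => [] [] // /addIn.
Qed.

Lemma gconj_feasible b C D M :
  M \in feasible b C D -> leftmost C D M -> gconj (feasible b C D) = colsums M.
Proof.
move=> MS lM; have maxE : maximals (feasible b C D) = [set M].
  apply/setP => A; rewrite in_set in_set1.
  apply/andP/eqP => [[AS /forall_inP /(_ M MS)]|->].
    by rewrite (leftmost_dominates AS MS lM); apply: leftmost_unique AS MS lM.
  split=> //; apply/forall_inP => B BS.
  by rewrite (leftmost_dominates BS MS lM) implybT.
rewrite /gconj maxE; case: pickP => [A /eqP/set1_inj->|/(_ M)] //.
by rewrite eqxx.
Qed.

(** * Column sums when at most one row is blocked *)

Section Blocking.

Variables C D : 'M[bool]_(m, n).
Hypothesis one_blocked : forall j l, \sum_i (C i j || D i l) <= 1.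

(** Without a shiftable row, [A i p <= A i q + (C i p || D i q)] for every [i]; summing over [i],
    column [p] exceeds column [q] by at most 1. *)
Lemma shiftable_row A (p q : 'I_n) :
  (nth 0 (colsums A) q).+1 < nth 0 (colsums A) p ->
  exists i, shiftable C D A i p q.
Proof.
move=> lt_qp; apply/existsP; apply: contraLR lt_qp.
rewrite negb_exists -leqNgt !nth_colsums => /forallP no_shift.
rewrite -addn1 (leq_trans _ (leq_add (leqnn _) (one_blocked p q))) //.
rewrite -big_split leq_sum //= => i _; have := no_shift i; rewrite /shiftable.
by case: (A i p) (A i q) (C i p) (D i q) => [] [] [] [].
Qed.

Lemma leftmost_colsums M (j l : nat) : leftmost C D M -> j < l < n ->
  nth 0 (colsums M) l <= (nth 0 (colsums M) j).+1.
Proof.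
move=> lM /andP[lt_jl lt_ln]; rewrite leqNgt; apply/negP => lt_c.
have [i] := @shiftable_row M (Ordinal lt_ln) (Ordinal (ltn_trans lt_jl lt_ln)) lt_c.
exact/negP/lM.
Qed.

(* Between the first column p where c exceeds a and the first later column q
   where the prefix sums agree again, one has c_p > a_p >= a_q > c_q: two
   rows could move a 1 from p to q, and at most one of them is blocked. *)
Lemma dominated_feasible b a M :
  sorted geq a -> \sum_(j < n) tnth a j = \sum_(i < m) tnth b i ->
  M \in feasible b C D -> dominated a (colsums M) ->
  exists2 A, A \in feasible b C D & colsums A = a.
Proof.
move=> sa sum_ab MS aM.
pose Q := [pred B | (B \in feasible b C D) && dominated a (colsums B)].
have Q_M : Q M by rewrite /= MS.
have bound B : colweight B <= m * (n * n).
  apply: (@leq_trans (\sum_(i < m) \sum_(j < n) n)).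
    by do 2!(apply: leq_sum => ? _); case: (B _ _); rewrite ?mul1n // ltnW.
  by rewrite !sum_nat_const !card_ord.
case: (arg_maxnP colweight Q_M) => A /andP[AS /dominatedP aA] maxA.
exists A => //; apply/esym/psum_inj => k0 le_k0n; apply/eqP.
rewrite eqn_leq aA //= leqNgt; apply/negP => lt_k0.
have: exists k, (k <= n) && (psum a k < psum (colsums A) k).
  by exists k0; rewrite le_k0n.
(* The first prefix with strict excess has length [p.+1], so its last column, [p] counted from 0, is
   where [A] has more 1s than [a] asks for. *)
case/ex_minnP => -[|p] /andP[lt_pn lt_p] minp; first by rewrite !psum0 in lt_p.
have le_p : psum (colsums A) p <= psum a p.
  rewrite leqNgt; apply/negP => lt'.
  by have := minp p; rewrite lt' (ltnW lt_pn) ltnn => /(_ isT).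
have total : psum a n = psum (colsums A) n.
  have all_j (F : 'I_n -> nat) : \sum_(j < n | j < n) F j = \sum_(j < n) F j.
    by apply: eq_bigl => j; rewrite ltn_ord.
  case/feasibleP: AS => rA _ _; rewrite psumE psum_colsums all_j sum_ab.
  by apply: eq_bigr => i _; rewrite -rA all_j.
have: exists l, (p < l) && (psum (colsums A) l <= psum a l).
  by exists n; rewrite total leqnn lt_pn.
(* Likewise [q.+1] is the first length beyond [p] at which the excess is gone; [n] is such a length
   because the totals agree. *)
case/ex_minnP => -[//|q] /andP[le_pq le_q] minq.
have lt_qn : q < n by apply: (minq n); rewrite total leqnn lt_pn.
have excess k : p < k <= q -> psum a k < psum (colsums A) k.
  case/andP=> lt_pk le_kq; rewrite ltnNge; apply/negP => le'.
  by have := minq k; rewrite lt_pk le' => /(_ isT); lia.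
have lt_pq : p < q by rewrite ltn_neqAle; case: eqP le_q => [<-|]; lia.
have [] := @shiftable_row A (Ordinal lt_pn) (Ordinal lt_qn).
  have := excess q; rewrite lt_pq leqnn => /(_ isT).
  have := nth_nonincr sa (ltnW lt_pq); move: le_q lt_p; rewrite !psumS /=; lia.
move=> i sh; case/and4P: (sh) => Ap Aq _ _.
suff shQ : Q (shift A i (Ordinal lt_pn) (Ordinal lt_qn)).
  by have := maxA _ shQ; have := colweight_shift Ap Aq; rewrite /geq /=; lia.
(* The move lowers, by 1, exactly the prefix sums of length [k] with [p < k <= q], where [excess]
   provides the slack. *)
rewrite /= (shift_feasible AS sh); apply/dominatedP => k le_kn.
have := psum_shift k Ap Aq; have := aA k le_kn; have := excess k; rewrite /=; lia.
Qed.

(** A leftmost [M] replaces [gconj] by explicit column sums, and the same [M] is the dominating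
    matrix from which the last implication starts. *)
Lemma feasible_tfae b a :
  sorted geq a -> \sum_(j < n) tnth a j = \sum_(i < m) tnth b i ->
  (exists A, A \in feasible b C D) ->
  [<-> exists2 A, A \in feasible b C D & colsums A = a;
       dominated a (gconj (feasible b C D));
       forall k, 1 <= k <= n -> psum a k <= psum (gconj (feasible b C D)) k;
       forall k, k \in corners a -> psum a k <= psum (gconj (feasible b C D)) k].
Proof.
move=> sa sum_ab /leftmost_exists[M MS lM]; rewrite (gconj_feasible MS lM).
tfae=> [[A AS <-]|/dominatedP aM k /andP[_]|aM k|aM].
- exact: leftmost_dominates AS MS lM.
- exact: aM.
- by rewrite inE => /andP[k_n _]; apply: aM.
- apply: (dominated_feasible sa sum_ab MS); apply/dominatedP.
  by apply: psum_le_corners => // j l; apply: leftmost_colsums.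
Qed.

End Blocking.

End Exchange.

(** * Specialization to filling and to avoiding *)

Theorem theorem3p7 (m n : nat) (a : n.-tuple nat) (b : m.-tuple nat)
  (C : 'M[bool]_(m, n))
  (a_noninc : sorted geq a)
  (b_le_n : \max_(i < m) tnth b i <= n)
  (sum_ab : \sum_(i < n) tnth a i = \sum_(i < m) tnth b i) :
  (fillable b C ->
     [<-> exists A : 'M[bool]_(m, n),
            [/\ fills A C, colsums A = a & rowsums A = b];
          dominated a (conj1 b C);
          forall k : nat, 1 <= k <= n -> psum a k <= psum (conj1 b C) k;
          forall k : nat, k \in corners a -> psum a k <= psum (conj1 b C) k])
  /\
  (avoidable b C ->
     [<-> exists A : 'M[bool]_(m, n),
            [/\ avoids A C, colsums A = a & rowsums A = b];
          dominated a (conj0 b C);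
          forall k : nat, 1 <= k <= n -> psum a k <= psum (conj0 b C) k;
          forall k : nat, k \in corners a -> psum a k <= psum (conj0 b C) k]).
Proof.
(* The zero matrix imposes no constraint: filling is feasibility for the pair [C], [O], avoiding for
   [O], [C]. In both cases [one_blocked] reduces to the column condition on [C]. *)
pose O : 'M[bool]_(m, n) := (const_mx false)%R.
have fillsO A : fills A O by apply/forallP => i; apply/forallP => j; rewrite mxE.
have avoidsO A : avoids A O by apply/forallP => i; apply/forallP => j; rewrite mxE.
have sumO i : \sum_j O i j = 0 by rewrite big1 // => j _; rewrite mxE.
have b_n i : tnth b i <= n.
  exact: leq_trans (leq_bigmax (F := fun i => tnth b i) i) b_le_n.
split=> /andP[/forallP rowC /forallP colC].
- have -> : conj1 b C = gconj (feasible b C O).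
    by congr gconj; apply/setP => A; rewrite !inE avoidsO andbT.
  have ex_iff : (exists A, [/\ fills A C, colsums A = a & rowsums A = b]) <->
      exists2 A, A \in feasible b C O & colsums A = a.
    split=> [[A [fA aA /eqP rA]]|[A]]; first by exists A; rewrite // inE rA fA /=.
    by rewrite inE => /and3P[/eqP rA fA _] aA; exists A.
  have one_blocked j l : \sum_i (C i j || O i l) <= 1.
    by under eq_bigr do rewrite mxE orbF; apply: colC.
  have ex_feasible : exists A, A \in feasible b C O.
    by apply: feasible_exists => // [i|i j _]; rewrite ?sumO ?addn0 ?mxE.
  have T := feasible_tfae one_blocked a_noninc sum_ab ex_feasible.
  by tfae=> [/ex_iff/(T 0 1)|/(T 1 2)|/(T 2 3)|/(T 3 0)/ex_iff].
- have -> : conj0 b C = gconj (feasible b O C).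
    by congr gconj; apply/setP => A; rewrite !inE fillsO.
  have ex_iff : (exists A, [/\ avoids A C, colsums A = a & rowsums A = b]) <->
      exists2 A, A \in feasible b O C & colsums A = a.
    split=> [[A [avA aA /eqP rA]]|[A]]; first by exists A; rewrite // inE rA avA fillsO.
    by rewrite inE => /and3P[/eqP rA _ avA] aA; exists A.
  have one_blocked j l : \sum_i (O i j || C i l) <= 1.
    by under eq_bigr do rewrite mxE; apply: colC.
  have ex_feasible : exists A, A \in feasible b O C.
    apply: feasible_exists => [i|i|i j]; rewrite ?sumO ?mxE //.
    (* Here [b_n] makes the truncated subtraction in [avoidable] exact. *)
    by rewrite -leq_subRL ?b_n; first exact: rowC.
  have T := feasible_tfae one_blocked a_noninc sum_ab ex_feasible.
  by tfae=> [/ex_iff/(T 0 1)|/(T 1 2)|/(T 2 3)|/(T 3 0)/ex_iff].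
Qed.
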